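(* Let $G$ be a Lie group with Lie algebra $\mathfrak g$. The Lie-Poisson structure on $\mathfrak g_2^*\times\mathfrak g_3^*$, the dual of the Lie algebra $\mathfrak g\circledS\mathfrak g$ of $G\circledS\mathfrak g$, is given by $$\{F,E\}(\mu,\nu)=\Big\langle\mu,\Big[\frac{\delta F}{\delta\mu},\frac{\delta E}{\delta\mu}\Big]\Big\rangle+\Big\langle\nu,\Big[\frac{\delta F}{\delta\mu},\frac{\delta E}{\delta\nu}\Big]-\Big[\frac{\delta E}{\delta\mu},\frac{\delta F}{\delta\nu}\Big]\Big\rangle,$$ and the Lie-Poisson equations for a function $H(\mu,\nu)$ on $\mathfrak g_2^*\times\mathfrak g_3^*$ read $$\frac{d\mu}{dt}=\mathrm{ad}^*_{\frac{\delta H}{\delta\mu}}\mu+\mathrm{ad}^*_{\frac{\delta H}{\delta\nu}}\nu,\qquad\frac{d\nu}{dt}=\mathrm{ad}^*_{\frac{\delta H}{\delta\mu}}\nu .$$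
   Context: $G$ is a (finite-dimensional) Lie group, $\mathfrak g=T_eG$; $\mathfrak g_2^*,\mathfrak g_3^*$ are copies of $\mathfrak g^*$. $\mathrm{Ad}_g=T_e(h\mapsto ghg^{-1})$, $\mathrm{ad}_\xi\eta=[\xi,\eta]=\frac{d}{dt}|_{t=0}\mathrm{Ad}_{\exp t\xi}\eta$, and $\mathrm{ad}^*_\xi$ on $\mathfrak g^*$ is defined by $\langle\mathrm{ad}^*_\xi\mu,\eta\rangle=-\langle\mu,[\xi,\eta]\rangle$. $G\circledS\mathfrak g$ is the group with law $(g,\xi)(h,\eta)=(gh,\xi+\mathrm{Ad}_g\eta)$; its Lie algebra $\mathfrak g\circledS\mathfrak g$ has bracket $[(\xi_1,\xi_2),(\eta_1,\eta_2)]=([\xi_1,\eta_1],[\xi_1,\eta_2]-[\eta_1,\xi_2])$. The Lie-Poisson bracket on the dual $\mathfrak k^*$ of a Lie algebra $\mathfrak k$ is $\{F,E\}(\kappa)=\langle\kappa,[dF(\kappa),dE(\kappa)]\rangle$, and the Lie-Poisson equations of $H$ are those for which $\dot F=\{F,H\}$ for all smooth $F$. $\frac{\delta F}{\delta\mu},\frac{\delta F}{\delta\nu}\in\mathfrak g$ are partial derivatives. *)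

(* Defs.v *)
From HB Require Import structures.
From mathcomp Require Import all_boot all_order all_algebra.
From mathcomp Require Import all_classical all_reals all_analysis.

Set Implicit Arguments.
Unset Strict Implicit.
Unset Printing Implicit Defensive.

Import Order.TTheory GRing.Theory Num.Theory.
Import numFieldNormedType.Exports.

Local Open Scope classical_set_scope.
Local Open Scope ring_scope.

(* [C^k] on an open set [A] of a finite-dimensional space: [f] is
   differentiable on [A] and its directional derivatives are [C^(k-1)]. *)
Fixpoint Ck (R : realType) (V W : normedModType R) (k : nat) (A : set V)
    (f : V -> W) : Prop :=
  match k with
  | 0 => forall x, A x -> {for x, continuous f}
  | k'.+1 => (forall x, A x -> differentiable f x) /\
             forall v, Ck k' A (fun x => 'D_v f x)
  end.

Definition smooth_on (R : realType) (V W : normedModType R) (A : set V)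
  (f : V -> W) : Prop := forall k, Ck k A f.

Definition smooth (R : realType) (V W : normedModType R) (f : V -> W) : Prop :=
  smooth_on setT f.

(* Only the values of [chart_map] on [chart_dom] and those of [chart_inv] on
   [chart_img] are meaningful. *)
Record chart (R : realType) (n : nat) (G : topologicalType) := Chart {
  chart_dom : set G;
  chart_map : G -> 'rV[R]_n;
  chart_inv : 'rV[R]_n -> G;
  chart_dom_open : open chart_dom;
  chart_img_open : open (chart_map @` chart_dom);
  chart_mapK : forall g, chart_dom g -> chart_inv (chart_map g) = g;
  chart_map_cont : forall g, chart_dom g -> {for g, continuous chart_map};
  chart_inv_cont : forall x, (chart_map @` chart_dom) x ->
    {for x, continuous chart_inv} }.

Definition chart_img (R : realType) (n : nat) (G : topologicalType)
  (c : chart R n G) : set 'rV[R]_n := chart_map c @` chart_dom c.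

(* The manifold structure is given by an atlas indexed by the points of [G],
   [chart_at g] being a chart around [g]. *)
HB.mixin Record isLieGroup (R : realType) (n : nat) (G : Type)
    of Topological G & Group G := {
  lie_hausdorff : hausdorff_space G;
  lie_second_countable : @second_countable G;
  chart_at : G -> chart R n G;
  chart_at_dom : forall g, chart_dom (chart_at g) g;
  chart_at_compat : forall a b : G,
    smooth_on (chart_map (chart_at a) @`
                 (chart_dom (chart_at a) `&` chart_dom (chart_at b)))
      (chart_map (chart_at b) \o chart_inv (chart_at a));
  lie_mul_cont : continuous (fun p : G * G => (p.1 * p.2)%g);
  lie_inv_cont : continuous (fun g : G => (g^-1)%g);
  lie_mul_smooth : forall a b c : G,
    smooth_on
      [set p : 'rV[R]_n * 'rV[R]_n |
        [/\ chart_img (chart_at a) p.1, chart_img (chart_at b) p.2 &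
            chart_dom (chart_at c)
              (chart_inv (chart_at a) p.1 * chart_inv (chart_at b) p.2)%g]]
      (fun p => chart_map (chart_at c)
              (chart_inv (chart_at a) p.1 * chart_inv (chart_at b) p.2)%g);
  lie_inv_smooth : forall a c : G,
    smooth_on
      [set x : 'rV[R]_n | chart_img (chart_at a) x /\
         chart_dom (chart_at c) ((chart_inv (chart_at a) x)^-1)%g]
      (fun x => chart_map (chart_at c) ((chart_inv (chart_at a) x)^-1)%g) }.

#[short(type="lieGroupType")]
HB.structure Definition LieGroup (R : realType) (n : nat) :=
  { G of isLieGroup R n G & Topological G & Group G }.

Section LieAlgebraOfLieGroup.
Context {R : realType} {n : nat} (G : lieGroupType R n).

(* [T_e G] is represented by ['rV[R]_n] through [e_chart]. *)
Definition e_chart : chart R n G := chart_at (1%g : G).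

Definition Ad (g : G) (eta : 'rV[R]_n) : 'rV[R]_n :=
  'd (fun x : 'rV[R]_n =>
        chart_map e_chart (g * chart_inv e_chart x * g^-1)%g)
     (chart_map e_chart (1%g : G)) eta.

(* [gamma] is the curve [t |-> exp (t xi)]. *)
Definition one_parameter_subgroup (xi : 'rV[R]_n) (gamma : R -> G) : Prop :=
  [/\ continuous gamma,
      forall s t, gamma (s + t) = (gamma s * gamma t)%g &
      is_derive (0 : R) 1 (fun t => chart_map e_chart (gamma t)) xi].

End LieAlgebraOfLieGroup.

Record lie_bracket (R : realType) (V : lmodType R) (br : V -> V -> V) : Prop :=
  LieBracket {
    lie_linearl : forall a x y z, br (a *: x + y) z = a *: br x z + br y z;
    lie_linearr : forall a x y z, br z (a *: x + y) = a *: br z x + br z y;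
    lie_alternating : forall x, br x x = 0;
    lie_jacobi : forall x y z,
      br x (br y z) + br y (br z x) + br z (br x y) = 0 }.

(* [T_e G] with [br] is the Lie algebra of [G]:
   [br xi eta] is the derivative of [Ad_(exp (t xi)) eta] at [t = 0]. *)
Definition lie_algebra_of (R : realType) (n : nat) (G : lieGroupType R n)
    (br : 'rV[R]_n -> 'rV[R]_n -> 'rV[R]_n) : Prop :=
  lie_bracket br /\
  forall (xi eta : 'rV[R]_n) (gamma : R -> G),
    one_parameter_subgroup xi gamma ->
    is_derive (0 : R) 1 (fun t => Ad (gamma t) eta) (br xi eta).

(* Bracket of the Lie algebra of the semidirect product of [G] and its Lie
   algebra, for the law [(g, xi) (h, eta) = (g h, xi + Ad g eta)]. *)
Definition semidirect_bracket (V : zmodType) (br : V -> V -> V) (x y : V * V) :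
    V * V :=
  (br x.1 y.1, br x.1 y.2 - br y.1 x.2).

(* The dual of ['rV[R]_n] is ['cV[R]_n]. *)
Definition pairing (R : realType) (n : nat) (mu : 'cV[R]_n) (xi : 'rV[R]_n) : R :=
  (xi *m mu) 0 0.

Definition pairing2 (R : realType) (n : nat) (k : 'cV[R]_n * 'cV[R]_n)
    (x : 'rV[R]_n * 'rV[R]_n) : R :=
  pairing k.1 x.1 + pairing k.2 x.2.

Definition coadjoint (R : realType) (n : nat)
    (br : 'rV[R]_n -> 'rV[R]_n -> 'rV[R]_n) (xi : 'rV[R]_n) (mu : 'cV[R]_n) :
    'cV[R]_n :=
  xget 0 [set al | forall eta, pairing al eta = - pairing mu (br xi eta)].

(* The differential at [k] of a function on the dual [Vd] of [V], as an element
   of [V] through the pairing [pr]. *)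
Definition dual_diff (R : realType) (V Vd : normedModType R)
    (pr : Vd -> V -> R) (F : Vd -> R) (k : Vd) : V :=
  xget 0 [set x | forall dl, pr dl x = 'd F k dl].

Definition lie_poisson (R : realType) (V Vd : normedModType R)
    (pr : Vd -> V -> R) (br : V -> V -> V) (F E : Vd -> R) (k : Vd) : R :=
  pr k (br (dual_diff pr F k) (dual_diff pr E k)).

(* [c] solves the Lie-Poisson equations of [H] on the time interval [J]. *)
Definition lie_poisson_equations (R : realType) (V Vd : normedModType R)
    (pr : Vd -> V -> R) (br : V -> V -> V) (H : Vd -> R) (J : set R)
    (c : R -> Vd) : Prop :=
  forall F : Vd -> R, smooth F ->
    forall t, J t -> is_derive t 1 (F \o c) (lie_poisson pr br F H (c t)).

Definition ddmu (R : realType) (n : nat) (F : 'cV[R]_n * 'cV[R]_n -> R)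
    (mu nu : 'cV[R]_n) : 'rV[R]_n :=
  dual_diff (@pairing R n) (fun m => F (m, nu)) mu.

Definition ddnu (R : realType) (n : nat) (F : 'cV[R]_n * 'cV[R]_n -> R)
    (mu nu : 'cV[R]_n) : 'rV[R]_n :=
  dual_diff (@pairing R n) (fun m => F (mu, m)) nu.

(* Main.v *)
(** Under the pairing, the functional derivative of [F] on the product is the
    pair of its partial functional derivatives, which gives the bracket.
    Antisymmetry of [br] and the definition of [ad^*] then rewrite
    [{F, H} (mu, nu)] as [dF (mu, nu) X_H] where [X_H] is the right-hand side of
    the claimed equations. A solution of these thus satisfies [F' = {F, H}] by
    the chain rule; conversely, taking for [F] the coordinate functions
    recovers the equations entry by entry. *)
Require Import Defs.
From HB Require Import structures.
From mathcomp Require Import all_boot all_order all_algebra.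
From mathcomp Require Import all_classical all_reals all_analysis.

Set Implicit Arguments.
Unset Strict Implicit.
Unset Printing Implicit Defensive.

Import Order.TTheory GRing.Theory Num.Theory.
Import numFieldNormedType.Exports.

Local Open Scope classical_set_scope.
Local Open Scope ring_scope.

Section Pairing.
Context {R : realType} {n : nat}.
Implicit Types (mu : 'cV[R]_n) (xi : 'rV[R]_n).

Lemma pairingE mu xi : pairing mu xi = \sum_i xi 0 i * mu i 0.
Proof. by rewrite /pairing mxE. Qed.

Lemma pairingDl mu1 mu2 xi :
  pairing (mu1 + mu2) xi = pairing mu1 xi + pairing mu2 xi.
Proof. by rewrite /pairing mulmxDr mxE. Qed.

Lemma pairingBr mu xi1 xi2 :
  pairing mu (xi1 - xi2) = pairing mu xi1 - pairing mu xi2.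
Proof. by rewrite /pairing mulmxBl !mxE. Qed.

Lemma pairingNr mu xi : pairing mu (- xi) = - pairing mu xi.
Proof. by rewrite /pairing mulNmx mxE. Qed.

Lemma pairing0l xi : pairing 0 xi = 0.
Proof. by rewrite /pairing mulmx0 mxE. Qed.

Lemma pairing_deltar xi i : pairing (delta_mx i 0) xi = xi 0 i.
Proof. by rewrite /pairing -colE mxE. Qed.

Lemma pairing_injr xi1 xi2 :
  (forall mu, pairing mu xi1 = pairing mu xi2) -> xi1 = xi2.
Proof. by move=> e; apply/rowP => i; rewrite -!pairing_deltar. Qed.

(** Expanding [mu] in the standard basis shows that the row of values of [f] on that basis
    represents [f]. This is the witness that keeps [xget] in [dual_diff] away from its default. *)
Lemma pairing_row_form (f : {linear 'cV[R]_n -> R}) mu :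
  pairing mu (\row_i f (delta_mx i 0)) = f mu.
Proof.
rewrite pairingE [in RHS](matrix_sum_delta mu) linear_sum.
by apply: eq_bigr => i _; rewrite big_ord1 linearZ mxE mulrC.
Qed.

(** The same representation on the other side of the pairing; it supplies the witness for
    [coadjoint]. *)
Lemma pairing_col_form (f : {linear 'rV[R]_n -> R}) xi :
  pairing (\col_i f (delta_mx 0 i)) xi = f xi.
Proof.
rewrite pairingE [in RHS](matrix_sum_delta xi) big_ord1 linear_sum.
by apply: eq_bigr => i _; rewrite linearZ mxE.
Qed.

Lemma pairing_dual_diff (f : 'cV[R]_n -> R) mu dl :
  pairing dl (dual_diff (@pairing R n) f mu) = 'd f mu dl.
Proof.
rewrite /dual_diff; case: xgetP => [x _ //|/(_ (\row_i 'd f mu (delta_mx i 0)))].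
by case=> al; rewrite pairing_row_form.
Qed.

(** Chain rule along the two slices through [(mu, nu)], whose differentials are the inclusions of
    the factors; the two contributions add up by linearity of ['d F (mu, nu)]. *)
Lemma pairing2_partials (F : 'cV[R]_n * 'cV[R]_n -> R) mu nu dl :
  differentiable F (mu, nu) ->
  pairing2 dl (ddmu F mu nu, ddnu F mu nu) = 'd F (mu, nu) dl.
Proof.
case: dl => a b dF; rewrite /pairing2 /= !pairing_dual_diff.
have ime : is_diff mu (fun m => (m, nu)) (fun m => (m, 0)).
  exact: (is_diff_pair (is_diff_id mu) (is_diff_cst nu mu)).
have inu : is_diff nu (fun m => (mu, m)) (fun m => (0, m)).
  exact: (is_diff_pair (is_diff_cst mu nu) (is_diff_id nu)).
have dmu : 'd (fun m => F (m, nu)) mu a = 'd F (mu, nu) (a, 0).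
  have iF := is_diff_comp ime (differentiableP dF).
  by case: iF => _ /(congr1 (@^~ a)); exact.
have dnu : 'd (fun m => F (mu, m)) nu b = 'd F (mu, nu) (0, b).
  have iF := is_diff_comp inu (differentiableP dF).
  by case: iF => _ /(congr1 (@^~ b)); exact.
rewrite [X in X + _]dmu [X in _ + X]dnu -linearD.
by congr ('d F _ _); congr pair; rewrite /= ?addr0 ?add0r.
Qed.

Lemma dual_diff_pairing2 (F : 'cV[R]_n * 'cV[R]_n -> R) mu nu :
  differentiable F (mu, nu) ->
  dual_diff (@pairing2 R n) F (mu, nu) = (ddmu F mu nu, ddnu F mu nu).
Proof.
move=> dF; rewrite {1}/dual_diff; case: xgetP => [[x y] _ /= xyP|]; last first.
  by move=> /(_ (ddmu F mu nu, ddnu F mu nu))[] dl; exact: pairing2_partials.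
(* The pairing is nondegenerate, and test vectors [(al, 0)] and [(0, al)] isolate one component
   each. *)
congr (_, _); apply: pairing_injr => al.
- have := pairing2_partials (al, 0) dF; rewrite -xyP /pairing2 /=.
  by rewrite !pairing0l !addr0.
- have := pairing2_partials (0, al) dF; rewrite -xyP /pairing2 /=.
  by rewrite !pairing0l !add0r.
Qed.

End Pairing.

Section LieBracket.
Context {R : realType} {n : nat}.

Lemma lie_bracketC (V : lmodType R) (br : V -> V -> V) (brL : lie_bracket br)
    x y : br x y = - br y x.
Proof.
have addl a b z : br (a + b) z = br a z + br b z.
  by have := lie_linearl brL 1 a b z; rewrite !scale1r.
have addr a b z : br z (a + b) = br z a + br z b.
  by have := lie_linearr brL 1 a b z; rewrite !scale1r.
have := lie_alternating brL (x + y).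
rewrite addl !addr !(lie_alternating brL) add0r addr0 => /eqP.
by rewrite addr_eq0 => /eqP.
Qed.

Implicit Types br : 'rV[R]_n -> 'rV[R]_n -> 'rV[R]_n.

(** Linearity of the bracket in its second argument makes the right-hand side a linear form in
    [eta], hence represented by a column, so the default 0 of [xget] is not taken. *)
Lemma pairing_coadjoint br (brL : lie_bracket br) xi mu eta :
  pairing (coadjoint br xi mu) eta = - pairing mu (br xi eta).
Proof.
have lin : linear (fun z => - pairing mu (br xi z) : R).
  move=> a u v; rewrite (lie_linearr brL) /pairing mulmxDl -scalemxAl !mxE.
  by rewrite opprD -mulrN.
pose f : {linear 'rV[R]_n -> R} := HB.pack (fun z => - pairing mu (br xi z) : R)
  (GRing.isLinear.Build _ _ _ _ _ lin).
rewrite /coadjoint; case: xgetP => [al _ //|/(_ (\col_i f (delta_mx 0 i)))].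
by case=> z; rewrite pairing_col_form.
Qed.

(** The pair on the right is the coadjoint action of [(z, w)] on [(mu, nu)] in the semidirect
    product. Swapping [x] with [z] and with [w] gives the signs that the minus in [coadjoint]
    absorbs. *)
Lemma pairing2_semidirect_bracket br (brL : lie_bracket br) mu nu x y z w :
  pairing2 (mu, nu) (semidirect_bracket br (x, y) (z, w)) =
  pairing2 (coadjoint br z mu + coadjoint br w nu, coadjoint br z nu) (x, y).
Proof.
rewrite /pairing2 /= pairingDl !(pairing_coadjoint brL) pairingBr.
rewrite (lie_bracketC brL x z) (lie_bracketC brL x w).
by rewrite !pairingNr addrA.
Qed.

Lemma lie_poisson_semidirect br (brL : lie_bracket br)
    (F H : 'cV[R]_n * 'cV[R]_n -> R) mu nu :
  differentiable F (mu, nu) -> differentiable H (mu, nu) ->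
  lie_poisson (@pairing2 R n) (semidirect_bracket br) F H (mu, nu) =
  'd F (mu, nu)
    (coadjoint br (ddmu H mu nu) mu + coadjoint br (ddnu H mu nu) nu,
     coadjoint br (ddmu H mu nu) nu).
Proof.
move=> dF dH; rewrite /lie_poisson !dual_diff_pairing2 //.
by rewrite pairing2_semidirect_bracket // pairing2_partials.
Qed.

End LieBracket.

Section Smooth.
Context {R : realType} {V : normedModType R}.

Lemma smooth_differentiable (W : normedModType R) (f : V -> W) (x : V) :
  smooth f -> differentiable f x.
Proof. by move=> /(_ 1%N)[+ _]; apply. Qed.

Lemma Ck_cst (W : normedModType R) k (A : set V) (w : W) :
  Ck k A (cst w).
Proof.
elim: k w => [|k IHk] w /=; first by move=> x _; exact: cvg_cst.
split=> [x _|v]; first exact: differentiable_cst.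
(* The derivative is again constant but with value 0, hence the induction for all [w]. *)
rewrite (_ : (fun x => _) = cst 0) //.
by apply/funext => x; exact: derive_cst.
Qed.

(** The derivative along [v] is the constant [f v], so all higher orders reduce to constants. This
    admits coordinates as test functions in [lie_poisson_equations]. *)
Lemma smooth_linear (W : normedModType R) (f : {linear V -> W}) :
  continuous f -> smooth f.
Proof.
move=> cf [|k] /=; first by move=> x _; exact: cf.
split=> [x _|v]; first exact: linear_differentiable.
rewrite (_ : (fun x => _) = cst (f v)); first exact: Ck_cst.
by apply/funext => x; rewrite deriveE ?diff_lin//; exact: linear_differentiable.
Qed.

End Smooth.

Lemma is_derive_mx (R : realFieldType) (V : normedModType R) (m n : nat)
    (M : V -> 'M[R]_(m, n)) (D : 'M[R]_(m, n)) (t v : V) :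
  (forall i j, is_derive t v (fun s => M s i j) (D i j)) -> is_derive t v M D.
Proof.
move=> dM; have M' : derivable M t v by apply/derivable_mxP => i j; case: (dM i j).
apply: DeriveDef => //; rewrite derive_mx //.
by apply/matrixP => i j; rewrite mxE; case: (dM i j).
Qed.

Lemma is_derive_comp_diff (R : numFieldType) (V W : normedModType R)
    (c : R -> V) (F : V -> W) (t : R) (v : V) :
  is_derive t 1 c v -> differentiable F (c t) ->
  is_derive t 1 (F \o c) ('d F (c t) v).
Proof.
case=> /derivable1_diffP dc <- dF; have dFc := differentiable_comp dc dF.
apply: DeriveDef; first exact: diff_derivable.
by rewrite !deriveE // diff_comp.
Qed.

Lemma is_derive_pair (R : numFieldType) (V W : normedModType R)
    (f : R -> V) (g : R -> W) (t : R) (v : V) (w : W) :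
  is_derive t 1 f v -> is_derive t 1 g w ->
  is_derive t 1 (fun s => (f s, g s)) (v, w).
Proof.
move=> [/derivable1_diffP df <-] [/derivable1_diffP dg <-].
have dfg := differentiable_pair df dg.
apply: DeriveDef; first exact: diff_derivable.
by rewrite !deriveE // diff_pair.
Qed.

Theorem proposition4p12 (R : realType) (n : nat) (G : lieGroupType R n)
    (br : 'rV[R]_n -> 'rV[R]_n -> 'rV[R]_n) (hbr : lie_algebra_of G br) :
  (forall F E : 'cV[R]_n * 'cV[R]_n -> R, smooth F -> smooth E ->
    forall mu nu : 'cV[R]_n,
      lie_poisson (@pairing2 R n) (semidirect_bracket br) F E (mu, nu) =
      pairing mu (br (ddmu F mu nu) (ddmu E mu nu)) +
      pairing nu (br (ddmu F mu nu) (ddnu E mu nu) -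
                  br (ddmu E mu nu) (ddnu F mu nu)))
  /\
  (forall H : 'cV[R]_n * 'cV[R]_n -> R, smooth H ->
    forall (J : set R) (mu nu : R -> 'cV[R]_n), open J -> is_interval J ->
      lie_poisson_equations (@pairing2 R n) (semidirect_bracket br) H J
        (fun t => (mu t, nu t)) <->
      (forall t, J t ->
        is_derive t 1 mu
          (coadjoint br (ddmu H (mu t) (nu t)) (mu t) +
           coadjoint br (ddnu H (mu t) (nu t)) (nu t)) /\
        is_derive t 1 nu (coadjoint br (ddmu H (mu t) (nu t)) (nu t)))).
Proof.
case: hbr => brL _.
split=> [F E sF sE mu nu|H sH J mu nu _ _].
  by rewrite /lie_poisson !dual_diff_pairing2; [|exact: smooth_differentiable..].
split=> [eqs t Jt|eqs F sF t Jt]; last first.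
  have [dmu dnu] := eqs t Jt.
  rewrite lie_poisson_semidirect; [|exact: brL|exact: smooth_differentiable..].
  exact: is_derive_comp_diff (is_derive_pair dmu dnu) (smooth_differentiable _ sF).
(* A continuous linear test function is its own differential, so its bracket with [H] is its value
   at the Hamiltonian vector field. *)
have key (f : {linear ('cV[R]_n * 'cV[R]_n)%type -> R}) : continuous f ->
    is_derive t 1 (fun s => f (mu s, nu s))
      (f (coadjoint br (ddmu H (mu t) (nu t)) (mu t) +
          coadjoint br (ddnu H (mu t) (nu t)) (nu t),
          coadjoint br (ddmu H (mu t) (nu t)) (nu t))).
  move=> cf; have sf := smooth_linear cf.
  have := eqs f sf t Jt.
  rewrite lie_poisson_semidirect; [|exact: brL|exact: smooth_differentiable..].
  by rewrite diff_lin.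
(* Apply [key] to each entry of the first component, then of the second. *)
split; apply: is_derive_mx => i j.
- have lin : linear (fun k : 'cV[R]_n * 'cV[R]_n => k.1 i j : R).
    by move=> a u v; rewrite !mxE.
  pose f : {linear _ -> R} := HB.pack
    (fun k : 'cV[R]_n * 'cV[R]_n => k.1 i j : R)
    (GRing.isLinear.Build _ _ _ _ _ lin).
  apply: (key f) => k.
  apply: (@continuous_comp _ _ _ fst (fun N : 'cV[R]_n => N i j : R)).
    exact: cvg_fst.
  exact: coord_continuous.
- have lin : linear (fun k : 'cV[R]_n * 'cV[R]_n => k.2 i j : R).
    by move=> a u v; rewrite !mxE.
  pose f : {linear _ -> R} := HB.pack
    (fun k : 'cV[R]_n * 'cV[R]_n => k.2 i j : R)
    (GRing.isLinear.Build _ _ _ _ _ lin).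
  apply: (key f) => k.
  apply: (@continuous_comp _ _ _ snd (fun N : 'cV[R]_n => N i j : R)).
    exact: cvg_snd.
  exact: coord_continuous.
Qed.
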